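(* Let $G$ be a finite group. Then for all $n$ there exists a word $w\in F_{n}$ such that for all $g_{1},g_{2},\ldots,g_{n}\in G$, the tuple $(g_{1},g_{2},\ldots,g_{n})$ satisfies $w$ if and only if the subgroup $\langle g_{1},g_{2},\ldots,g_{n}\rangle\leq G$ is solvable.
   Context: $F_{n}$ denotes the free group on $n$ letters ($n$ a natural number). For a group $G$ and $w\in F_{n}$, the $n$-tuple $(g_{1},\ldots,g_{n})\in G^{n}$ satisfies $w$ if substituting $g_i$ for the $i$-th letter gives $w(g_{1},\ldots,g_{n})=1$ in $G$. *)

(* Defs.v *)
From HB Require Import structures.
From mathcomp Require Import all_boot all_fingroup all_solvable.

Set Implicit Arguments.
Unset Strict Implicit.
Unset Printing Implicit Defensive.

Import GroupScope.

(* (i, false) stands for the letter x_i and (i, true) for its inverse. *)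
Notation letter n := ('I_n * bool)%type.

Section Reduction.

Variable n : nat.
Implicit Types (a b : letter n) (s t : seq (letter n)).

Definition letter_inv a : letter n := (a.1, ~~ a.2).

Definition reduced s : bool := sorted (fun a b => b != letter_inv a) s.

Definition push a s : seq (letter n) :=
  if s is b :: s' then if b == letter_inv a then s' else a :: s else [:: a].

Definition reduce s : seq (letter n) := foldr push [::] s.

Definition word_inv s : seq (letter n) := rev (map letter_inv s).

Lemma letter_invK : involutive letter_inv.
Proof. by case=> i b; rewrite /letter_inv /= negbK. Qed.

Lemma push_reduced a s : reduced s -> reduced (push a s).
Proof.
case: s => [|b s] //= sR; case: ifP => [_|ab]; first exact: path_sorted sR.
by rewrite /= ab.
Qed.

Lemma pushK a s : reduced s -> push (letter_inv a) (push a s) = s.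
Proof.
case: s => [|b s] /=; first by rewrite letter_invK eqxx.
case: eqP => [->|_]; last by rewrite /= letter_invK eqxx.
by case: s => [|c s] //= /andP[/negPf ca _]; rewrite ca.
Qed.

Lemma pushKV a s : reduced s -> push a (push (letter_inv a) s) = s.
Proof. by move=> sR; rewrite -{1}(letter_invK a) pushK. Qed.

Lemma foldr_push_reduced s t : reduced t -> reduced (foldr push t s).
Proof. by move=> tR; elim: s => //= a s; apply: push_reduced. Qed.

Lemma reduce_reduced s : reduced (reduce s).
Proof. exact: foldr_push_reduced. Qed.

Lemma reduce_id s : reduced s -> reduce s = s.
Proof.
elim: s => //= a s IHs sR; rewrite IHs; last exact: path_sorted sR.
by case: s sR {IHs} => //= b s /andP[/negPf->].
Qed.

Lemma foldr_push_push a s t :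
  reduced t -> foldr push t (push a s) = push a (foldr push t s).
Proof.
move=> tR; case: s => //= b s; case: eqP => // ->.
by rewrite pushKV // foldr_push_reduced.
Qed.

Lemma foldr_push_reduce s t :
  reduced t -> foldr push t (reduce s) = foldr push t s.
Proof. by move=> tR; elim: s => //= a s IHs; rewrite foldr_push_push ?IHs. Qed.

Lemma reduce_catl s t : reduce (reduce s ++ t) = reduce (s ++ t).
Proof. by rewrite /reduce !foldr_cat foldr_push_reduce // reduce_reduced. Qed.

Lemma reduce_catr s t : reduce (s ++ reduce t) = reduce (s ++ t).
Proof.
by rewrite /reduce !foldr_cat -/(reduce _) reduce_id // reduce_reduced.
Qed.

Lemma word_invK : involutive word_inv.
Proof. by move=> s; rewrite /word_inv map_rev revK (mapK letter_invK). Qed.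

Lemma word_inv_reduced s : reduced s -> reduced (word_inv s).
Proof.
rewrite /reduced /word_inv rev_sorted sorted_map; apply: sub_sorted => a b /=.
by apply: contra => /eqP ->; rewrite letter_invK.
Qed.

Lemma reduce_word_invl s : reduce (word_inv s ++ s) = [::].
Proof.
rewrite /reduce /word_inv; elim: s => //= a s IHs.
rewrite rev_cons cat_rcons !foldr_cat /= pushK ?reduce_reduced //.
by rewrite -foldr_cat.
Qed.

Lemma reduce_word_invr s : reduce (s ++ word_inv s) = [::].
Proof. by rewrite -{1}(word_invK s) reduce_word_invl. Qed.

End Reduction.

(* The free group on x_0, ..., x_(n - 1), as the group of reduced words under
   concatenation followed by free reduction *)
Record free_group (n : nat) := FreeGroup {
  fgword :> seq (letter n);
  fgword_reduced : reduced fgword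
}.

HB.instance Definition _ n := [isSub for @fgword n].
HB.instance Definition _ n := [Choice of free_group n by <:].

Section FreeGroup.

Variable n : nat.
Implicit Types u v w : free_group n.

Definition fg_one : free_group n := @FreeGroup n [::] isT.

Definition fg_mul u v : free_group n := FreeGroup (reduce_reduced (u ++ v)).

Definition fg_inv u : free_group n :=
  FreeGroup (word_inv_reduced (fgword_reduced u)).

Lemma fg_mulA : associative fg_mul.
Proof.
by move=> u v w; apply: val_inj; rewrite /= reduce_catl reduce_catr catA.
Qed.

Lemma fg_mul1g : left_id fg_one fg_mul.
Proof. by move=> u; apply: val_inj; rewrite /= reduce_id // fgword_reduced. Qed.

Lemma fg_mulg1 : right_id fg_one fg_mul.
Proof.
by move=> u; apply: val_inj; rewrite /= cats0 reduce_id // fgword_reduced.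
Qed.

Lemma fg_mulVg : left_inverse fg_one fg_inv fg_mul.
Proof. by move=> u; apply: val_inj; apply: reduce_word_invl. Qed.

Lemma fg_mulgV : right_inverse fg_one fg_inv fg_mul.
Proof. by move=> u; apply: val_inj; apply: reduce_word_invr. Qed.

HB.instance Definition _ :=
  isGroup.Build (free_group n) fg_mulA fg_mul1g fg_mulg1 fg_mulVg fg_mulgV.

Definition fg_gen (i : 'I_n) : free_group n := @FreeGroup n [:: (i, false)] isT.

End FreeGroup.

Section Evaluation.

Variables (n : nat) (H : groupType) (g : 'I_n -> H).
Implicit Types (a : letter n) (s : seq (letter n)) (w : free_group n).

Definition letter_eval a : H := if a.2 then (g a.1)^-1 else g a.1.

Definition seq_eval s : H := \prod_(a <- s) letter_eval a.

(* The value w(g_0, ..., g_(n - 1)) *)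
Definition word_eval w : H := seq_eval w.

Lemma letter_evalV a : letter_eval (letter_inv a) = (letter_eval a)^-1.
Proof. by case: a => i []; rewrite /letter_eval /= ?invgK. Qed.

Lemma seq_eval_push a s : seq_eval (push a s) = letter_eval a * seq_eval s.
Proof.
rewrite /seq_eval; case: s => [|b s] /=; first by rewrite big_seq1 big_nil mulg1.
case: eqP => [->|_]; last by rewrite big_cons.
by rewrite big_cons letter_evalV mulKVg.
Qed.

Lemma seq_eval_reduce s : seq_eval (reduce s) = seq_eval s.
Proof.
elim: s => //= a s IHs; rewrite seq_eval_push IHs.
by rewrite /seq_eval big_cons.
Qed.

Lemma word_eval_morph : monoid_morphism word_eval.
Proof.
split=> [|u v]; rewrite /word_eval; first by rewrite /seq_eval big_nil.
by rewrite /= seq_eval_reduce /seq_eval big_cat.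
Qed.

HB.instance Definition _ :=
  isUMagmaMorphism.Build (free_group n) H word_eval word_eval_morph.

Lemma word_eval_gen i : word_eval (fg_gen i) = g i.
Proof. by rewrite /word_eval /seq_eval big_seq1. Qed.

Lemma word_eval_unique (f : free_group n -> H) :
  monoid_morphism f -> (forall i, f (fg_gen i) = g i) -> f =1 word_eval.
Proof.
case=> f1 fM fg; have fV i : f (fg_gen i)^-1 = (g i)^-1.
  by apply: (mulgI (g i)); rewrite -{1}fg -fM !mulgV f1.
case=> s; rewrite /word_eval /=; elim: s => [|a s IHs] sR.
  rewrite /seq_eval big_nil -[RHS]f1; congr f; exact: val_inj.
have sR' : reduced s by apply: path_sorted sR.
have -> : FreeGroup sR =
    (if a.2 then (fg_gen a.1)^-1 else fg_gen a.1) * FreeGroup sR'.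
  apply: val_inj; rewrite /= -[LHS](reduce_id sR).
  by case: a {sR} => i [].
rewrite fM IHs /seq_eval big_cons; congr (_ * _).
by rewrite /letter_eval; case: ifP.
Qed.

End Evaluation.

Definition satisfies (n : nat) (H : groupType) (g : n.-tuple H)
    (w : free_group n) : Prop :=
  word_eval (tnth g) w = 1.

(* Main.v *)
Require Import Defs.
From mathcomp Require Import all_boot all_fingroup all_solvable.

Import GroupScope.

(** Evaluating a word at all n-tuples of elements of the finite group at once
    identifies a word, up to its values, with an element of the subgroup Gamma
    generated in the product of copies of the group, one for each tuple g, by
    the tautological elements a_j : g |-> g_j; the projection of Gamma at g is
    the subgroup generated by g. It thus suffices to find x in Gamma whose
    coordinate at g is trivial exactly when that projection is solvable.

    [perfect_solvable_projections] provides a perfect subgroup D of Gamma whose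
    projection at g is trivial exactly when that of Gamma is solvable. This
    settles the solvable tuples, where every element of D has coordinate 1.
    At the other tuples, the kernel of the projection is a proper normal
    subgroup of D, so it remains to find x in D outside all proper normal
    subgroups. A finite perfect group has such an element
    ([perfect_normal_generator]): its maximal normal subgroups behave like
    prime ideals for intersections ([perfect_maxnormal_prime]), and x is built
    by the argument of prime avoidance. Perfectness is essential: the Klein
    four-group is the union of its proper subgroups. *)

(** This is primality of a maximal normal subgroup M of a perfect group D. If
    neither A nor B lies in M, then both map onto the simple quotient D / M, so
    the perfect group D / M is the image of [~: A, B], which lies in A :&: B
    and hence in M. *)
Lemma perfect_maxnormal_prime {gT : finGroupType} {D M A B : {group gT}} :
    D \subset [~: D, D] -> maxnormal M D D -> A <| D -> B <| D ->
  A :&: B \subset M -> (A \subset M) || (B \subset M).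
Proof.
move=> perfD maxM nsAD nsBD sABM; have nsMD := maxnormal_normal maxM.
have nMD := normal_norm nsMD.
have nMs (K : {group gT}) : K <| D -> K \subset 'N(M).
  by move=> nsKD; apply: subset_trans (normal_sub nsKD) nMD.
have /simpleP[ntDM simDM] : simple (D / M) by rewrite quotient_simple.
have quoE (K : {group gT}) : K <| D -> ~~ (K \subset M) -> K / M = D / M.
  move=> nsKD; rewrite -quotient_sub1 ?nMs // => ntKM.
  have [|KM1|//] := simDM (K / M)%G; first exact: quotient_normal.
  by rewrite KM1 subxx in ntKM.
apply: contraNT ntDM; rewrite negb_or => /andP[nsAM nsBM].
rewrite -subG1 (subset_trans (quotientS M perfD)) // quotientR //.
rewrite -{1}(quoE A) // -(quoE B) // -quotientR ?nMs // quotient_sub1.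
  apply: subset_trans sABM; apply: commg_subI; rewrite subsetI subxx /=.
    exact: subset_trans (normal_sub nsAD) (normal_norm nsBD).
  exact: subset_trans (normal_sub nsBD) (normal_norm nsAD).
by rewrite comm_subG ?nMs.
Qed.

(** The group I is the intersection of the subgroups in s: by primality of M, it
    would otherwise follow that M contains one of them, which would then be M by
    maximality. *)
Lemma maxnormal_setI_not_sub {gT : finGroupType} {D M : {group gT}}
    (s : seq {group gT}) :
    D \subset [~: D, D] -> maxnormal M D D ->
    {in s, forall N : {group gT}, maxnormal N D D} -> M \notin s ->
  exists I : {group gT},
    [/\ I <| D, ~~ (I \subset M) & {in s, forall N : {group gT}, I \subset N}].
Proof.
move=> perfD maxM; elim: s => [_ _|N s IHs maxs].
  exists D; split=> //.
  by have := maxnormal_proper maxM; rewrite properE => /andP[].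
rewrite inE negb_or => /andP[neqMN /IHs[P sP|I [nsID nsIM sIs]]].
  by apply: maxs; rewrite inE sP orbT.
have maxN : maxnormal N D D by rewrite maxs ?mem_head.
exists (N :&: I)%G; split=> [||P].
- exact: normalI (maxnormal_normal maxN) nsID.
- apply: contra nsIM => sNIM.
  have /orP[sNM|//] := perfect_maxnormal_prime perfD maxM
    (maxnormal_normal maxN) nsID sNIM.
  case/maxgroupP: maxN => _ /(_ M) maxN; case/eqP: neqMN; apply/group_inj.
  by apply: maxN => //; case/maxgroupP: maxM.
- rewrite inE => /predU1P[-> | /sIs]; first exact: subsetIl.
  exact/subset_trans/subsetIr.
Qed.

(** A finite perfect group is the normal closure of a single element. It is
    enough to avoid the maximal normal subgroups, one after the other. *)
Lemma perfect_normal_generator {gT : finGroupType} {D : {group gT}} :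
    D \subset [~: D, D] ->
  exists2 x, x \in D & forall N : {group gT}, N <| D -> x \in N -> N :=: D.
Proof.
move=> perfD.
have avoid (s : seq {group gT}) :
    {in s, forall N : {group gT}, maxnormal N D D} ->
  exists2 x, x \in D & {in s, forall N : {group gT}, x \notin N}.
  elim: s => [_|M s IHs maxs]; first by exists 1.
  have maxM : maxnormal M D D by rewrite maxs ?mem_head.
  have maxs' : {in s, forall N : {group gT}, maxnormal N D D}.
    by move=> P sP; apply: maxs; rewrite inE sP orbT.
  have [x Dx xs] := IHs maxs'.
  have [Mx | M'x] := boolP (x \in M); last first.
    by exists x => // N; rewrite inE => /predU1P[->|/xs].
  have sM' : M \notin s by apply: contraL Mx => /xs.
  (* Multiplying x by some y outside M that lies in all the subgroups of s
     leaves M without entering any of them. *)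
  have [I [nsID /subsetPn[y Iy M'y] sIs]] :=
    maxnormal_setI_not_sub s perfD maxM maxs' sM'.
  exists (x * y) => [|N].
    by rewrite groupM // (subsetP (normal_sub nsID)).
  rewrite inE => /predU1P[-> | sN]; first by rewrite groupMl.
  by rewrite groupMr ?xs // (subsetP (sIs N sN)).
have [|x Dx x_max] := avoid (enum [pred N : {group gT} | maxnormal N D D]).
  by move=> N; rewrite mem_enum.
exists x => // N nsND Nx; apply/eqP; rewrite eqEsubset normal_sub //=.
apply: contraLR Nx => nsDN.
have [|M maxM sNM] := @maxgroup_exists _
  (fun K : {group gT} => (K \proper D) && (D \subset 'N(K))) N.
  by rewrite properE normal_sub // nsDN normal_norm.
by apply: contra (subsetP sNM x) _; apply: x_max; rewrite mem_enum.
Qed.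

Lemma mem_gen_word_eval {gT : finGroupType} {n : nat} {a : 'I_n -> gT} {x} :
  x \in <<[set a i | i : 'I_n]>> -> exists w : free_group n, word_eval a w = x.
Proof.
case/gen_prodgP=> m [c imc ->].
apply: (big_ind (fun y => exists w : free_group n, word_eval a w = y)).
- by exists 1; apply: (word_eval_morph a).1.
- by move=> _ _ [u <-] [v <-]; exists (u * v); apply: (word_eval_morph a).2.
- move=> k _; have /imsetP[i _ ->] := imc k.
  by exists (fg_gen i); apply: word_eval_gen.
Qed.

Lemma word_eval_dffun {I : finType} {gT : I -> finGroupType} {n : nat}
    (a : 'I_n -> {dffun forall i, gT i}) (i : I) (w : free_group n) :
  word_eval a w i = word_eval (fun j => a j i) w.
Proof.
rewrite /word_eval /seq_eval prodg_ffun; apply: eq_bigr => l _.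
by rewrite /letter_eval; case: l.2; rewrite ?invg_ffun.
Qed.

Lemma solvable_of_der1 {gT : finGroupType} (G : {group gT}) :
  solvable [~: G, G] -> solvable G.
Proof.
rewrite -derg1 => solG'; rewrite (series_sol (der_normal 1 G)) solG' /=.
by rewrite abelian_sol // sub_der1_abelian.
Qed.

(** The last term of the derived series of Gam would do for D. It is shorter to
    take a subgroup minimal among those whose projection is nonsolvable wherever
    that of Gam is. Passing to the derived subgroup preserves this property, so
    D is perfect; its projections are perfect too, hence trivial at the indices
    where Gam projects to a solvable group. *)
Lemma perfect_solvable_projections {I : finType} {gT : I -> finGroupType}
    (Gam : {group {dffun forall i, gT i}}) :
  exists2 D : {group {dffun forall i, gT i}},
    D \subset Gam /\ D \subset [~: D, D] &
    forall i, solvable (dffun_morphism gT i @* Gam) =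
              (dffun_morphism gT i @* D == 1).
Proof.
pose Q (D : {group {dffun forall i, gT i}}) := [forall i,
  solvable (dffun_morphism gT i @* D) ==> solvable (dffun_morphism gT i @* Gam)].
have QG : Q Gam by apply/forallP=> i; apply/implyP.
have [D /mingroupP[/forallP QD minD] sDG] := mingroup_exists QG.
have perfD : D \subset [~: D, D].
  suff defD : [~: D, D] = D by rewrite defD.
  apply: (minD [~: D, D]%G); last exact: comm_subG.
  apply/forallP=> i; apply/implyP=> sol; apply: (implyP (QD i)).
  by apply: solvable_of_der1; rewrite -morphimR ?subsetT.
exists D => // i; apply/idP/eqP=> [/forall_inP solG | D1].
  apply/eqP/(solG (dffun_morphism gT i @* D)%G).
  by rewrite subsetI morphimS //= -morphimR ?subsetT // morphimS.
by apply: (implyP (QD i)); rewrite D1 solvable1.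
Qed.

Theorem theorem1 (gT : finGroupType) (G : {group gT}) (n : nat) :
  exists w : free_group n,
    forall g : n.-tuple gT, {subset g <= G} ->
      (satisfies g w <-> solvable <<[set x in g]>>%g).
Proof.
pose a (j : 'I_n) : {dffun forall t : n.-tuple gT, gT} := [ffun t => tnth t j].
have [D [sDG perfD] solE] :=
  perfect_solvable_projections <<[set a j | j : 'I_n]>>%G.
have [x Dx x_gen] := perfect_normal_generator perfD.
have [w wx] := mem_gen_word_eval (subsetP sDG x Dx).
exists w => g _.
have imG : dffun_morphism (fun=> gT) g @* <<[set a j | j : 'I_n]>> = <<[set x in g]>>.
  rewrite morphim_gen ?subsetT // morphimEsub ?subsetT // -imset_comp.
  congr <<_>>; apply/setP=> y; rewrite inE; apply/imsetP/tnthP.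
    by case=> j _ ->; exists j; rewrite /= ffunE.
  by case=> j ->; exists j; rewrite //= ffunE.
have satE : satisfies g w <-> x g = 1.
  rewrite /satisfies -wx word_eval_dffun.
  suff -> : word_eval (tnth g) w = word_eval (fun j => a j g) w by [].
  by apply: eq_bigr => l _; rewrite /letter_eval ffunE.
pose f := dffun_morphism (fun=> gT) g.
rewrite -imG solE -subG1 sub_morphim_pre ?subsetT // -/('ker f).
split=> [/satE xg1 | sDK]; last first.
  by apply/satE; have /kerP := subsetP sDK x Dx; apply; rewrite inE.
have Kx : x \in 'ker f by apply/kerP; rewrite ?inE.
apply/setIidPl; apply: (x_gen ('ker_D f)%G); last by rewrite inE Dx Kx.
rewrite /normal subsetIl normsI ?normG //.
exact: subset_trans (subsetT D) (ker_norm f).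
Qed.
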